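(* Consider a system with limiting arrival rates $\Lambda$ and service rates $\mu$. Any menu $M$ such that $$\sum_{j\in S}\sum_{i\in[n]}\Lambda_i m_{ij}<\sum_{j\in S}\mu_j\qquad\text{for all } S\subsetneq[m]$$ will be admissible for any vector of slacks $\Gamma\in\mathbb{R}^n$ such that $|\Gamma|>0$. Furthermore, such a menu will induce a single CRP component.
   Context: There are $n$ customer classes and $m$ servers with service rates $\mu=(\mu_1,\dots,\mu_m)$; $[k]=\{1,\dots,k\}$ and $|x|=\sum_i x_i$. A menu is a matrix $M=[m_{ij}]\in\{0,1\}^{n\times m}$; class $i$ can be served by server $j$ iff $m_{ij}=1$. Limiting arrival rates are a vector $\Lambda\in\mathbb{R}_+^n$ (entries may be zero), with $|\Lambda|=|\mu|$. A vector of slacks $\Gamma$ specifies arrival rates $\lambda_i^{(\epsilon)}=\Lambda_i-\Gamma_i\epsilon+o(\epsilon)\ge 0$ for $i\in[n]$ and small $\epsilon>0$. Admissibility. For $S\subseteq[m]$, $U_S(M)=\{i\in[n]:\sum_{j\in S^c}m_{ij}=0\}$ is the set of classes that can only be served by servers in $S$, and $\Delta^{(\epsilon)}_S(M)=\sum_{j\in S}\mu_j-\sum_{i\in U_S(M)}\lambda_i^{(\epsilon)}$. $M$ is admissible under $\lambda^{(\epsilon)}$ and $\mu$ if $\Delta^{(\epsilon)}_S(M)=\Omega(\epsilon)$ for all $S\subseteq[m]$. ''Admissible for the slacks $\Gamma$'' means admissible under $\lambda^{(\epsilon)}=\Lambda-\epsilon\Gamma+o(\epsilon)$ and $\mu$.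 CRP components. $\mathcal{F}(0,\Lambda,M)$ is the set of $f=[f_{ij}]\ge0$ with $\sum_{i}f_{ij}\le\mu_j$ for all $j\in[m]$, $\sum_{j}f_{ij}=\Lambda_i$ for all $i\in[n]$, and $f_{ij}=0$ whenever $m_{ij}=0$. The residual matching $\breve M=[\breve m_{ij}]$ has $\breve m_{ij}=1$ iff some $f\in\mathcal{F}(0,\Lambda,M)$ has $f_{ij}>0$. A CRP (complete resource pooling) component is a pair $(\mathcal{C},\mathcal{S})$ of a set of classes and a set of servers such that any two nodes of $\mathcal{C}\cup\mathcal{S}$ are joined by a path in $\breve M$ (viewed as a bipartite graph), and which is maximal with this property. $M$ induces the collection of CRP components of its residual matching.
   Formalization: Printed condition is unsatisfiable at empty S and, for nonempty S, met by the zero menu; replaced by: every class has a server and Λ(U_S)<μ(S) for nonempty proper S. Admissibility is over nonempty S; components made only of zero-rate classes are not counted. *)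

(* Defs.v *)
(* MathComp / MathComp-Analysis. *)
From mathcomp Require Import all_boot all_order all_algebra.
From mathcomp Require Import boolp classical_sets filter reals topology normedtype landau.
(* Re-imported so that [set0] and set comprehensions denote finite sets. *)
From mathcomp Require Import finset fingraph.

Set Implicit Arguments.
Unset Strict Implicit.
Unset Printing Implicit Defensive.

Import Order.TTheory GRing.Theory Num.Theory.
Import numFieldNormedType.Exports.

Local Open Scope ring_scope.

Section Menus.
Variables (R : realType) (n m : nat).
Implicit Types (mu : 'I_m -> R) (Lambda Gamma : 'I_n -> R).
Implicit Types (M : 'M[bool]_(n, m)) (S : {set 'I_m}) (C : {set 'I_n}).

Local Notation zero_plus := (at_right (0 : R)).

Definition only_served_by M S : {set 'I_n} :=
  [set i | (\sum_(j in ~: S) M i j == 0)%N].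

(* A family of arrival rates is a function of eps; only its germ at 0+ is used. *)
Definition slack mu M (lambda : R -> 'I_n -> R) S (eps : R) : R :=
  \sum_(j in S) mu j - \sum_(i in only_served_by M S) lambda eps i.

(* Omega(eps) as eps -> 0+, with a sign: the library's [=Omega] compares norms
   and would accept negative functions. *)
Definition Omega_eps (g : R -> R) : Prop :=
  exists2 c : R, 0 < c & \forall eps \near zero_plus, c * eps <= g eps.

(* S ranges over nonempty sets: slack at set0 is minus a sum of arrival rates,
   hence never Omega(eps). *)
Definition admissible mu M (lambda : R -> 'I_n -> R) : Prop :=
  forall S, S != set0 -> Omega_eps (slack mu M lambda S).

Definition arrival_rates Lambda Gamma (lambda : R -> 'I_n -> R) : Prop :=
  (forall i, (fun eps : R^o => lambda eps i - (Lambda i - Gamma i * eps) : R^o)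
               =o_zero_plus (fun eps : R^o => eps))
  /\ \forall eps \near zero_plus, forall i, 0 <= lambda eps i.

Definition admissible_for_slacks mu Lambda M Gamma : Prop :=
  forall lambda, arrival_rates Lambda Gamma lambda -> admissible mu M lambda.

Definition feasible_flow mu Lambda M (f : 'M[R]_(n, m)) : Prop :=
  [/\ forall i j, 0 <= f i j,
      forall j, \sum_i f i j <= mu j,
      forall i, \sum_j f i j = Lambda i
    & forall i j, ~~ M i j -> f i j = 0].

Definition residual_matching mu Lambda M : 'M[bool]_(n, m) :=
  \matrix_(i, j)
    `[< exists2 f : 'M[R]_(n, m), feasible_flow mu Lambda M f & 0 < f i j >].

Definition bipartite_edge M : rel ('I_n + 'I_m) := fun u v =>
  match u, v with
  | inl i, inr j | inr j, inl i => M i j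
  | _, _ => false
  end.

Definition nodes C S : {set 'I_n + 'I_m} := (inl @: C) :|: (inr @: S).

Definition path_joined M C S : Prop :=
  {in nodes C S &, forall u v, connect (bipartite_edge M) u v}.

Definition CRP_component mu Lambda M C S : Prop :=
  let P := path_joined (residual_matching mu Lambda M) in
  P C S /\
  forall C' S', C \subset C' -> S \subset S' -> P C' S' -> C' = C /\ S' = S.

(* A class with zero limiting rate carries no flow, so it is isolated in the
   residual matching; such isolated classes are not counted. When all limiting
   rates are positive this says that there is exactly one CRP component. *)
Definition single_CRP_component mu Lambda M : Prop :=
  exists! CS : {set 'I_n} * {set 'I_m},
    CRP_component mu Lambda M CS.1 CS.2 /\
    ~ (CS.2 = set0 /\ forall i, i \in CS.1 -> Lambda i = 0).

(* The printed condition.  At S = set0 it reads 0 < 0, so it never holds; and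
   restricted to nonempty S it is satisfied by the zero menu, which serves
   no class. *)
Definition printed_condition mu Lambda M : Prop :=
  forall S, S \proper [set: 'I_m] ->
    \sum_(j in S) \sum_i Lambda i * (M i j)%:R < \sum_(j in S) mu j.

(* The condition under which the conclusion has content: every class has a
   server, and the classes that only S can serve leave S strictly
   underloaded in the limit, i.e. slack mu M (fun=> Lambda) S 0 > 0. *)
Definition corrected_condition mu Lambda M : Prop :=
  (forall i, exists j, M i j) /\
  (forall S, S != set0 -> S \proper [set: 'I_m] ->
    \sum_(i in only_served_by M S) Lambda i < \sum_(j in S) mu j).

End Menus.

(* Main.v *)
Require Import Defs.
From mathcomp Require Import all_boot all_order all_algebra.
From mathcomp Require Import boolp classical_sets filter reals topology normedtype landau.
From mathcomp Require Import lra fintype.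
From mathcomp Require Import finset fingraph.

Import Order.TTheory GRing.Theory Num.Theory.
Import numFieldNormedType.Exports.

Local Open Scope ring_scope.

Set Implicit Arguments.
Unset Strict Implicit.

(** The printed condition reads [0 < 0] at the empty set of servers, so only the
    corrected condition has to be treated: every class has a server, and the cut
    condition is strict at nonempty proper sets of servers.

    Admissibility is a first-order expansion.  For a nonempty proper set of
    servers the limit of the slack is positive, so the slack exceeds eps
    near zero.  For the full set the limit is zero by balance,
    and the slack is [|Gamma| eps] up to [o(eps)].

    For the component, the cut condition is first shown to be sufficient for a
    feasible flow ([feasible_flow_exists], a weighted form of Hall's theorem).
    As the condition is strict, a small amount can be reserved on every edge of
    each class with positive rate, and the rest of the rates still satisfies the
    cut condition; hence the residual matching is the menu restricted to the
    classes with positive rate ([residual_matchingE]).  Were the set [S] of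
    servers reachable from a given one proper, every such class would be served
    only by [S] or only by its complement, and adding the two strict cut
    inequalities would contradict balance ([servers_connected]).  So all servers
    and all classes with positive rate are connected, and every component with a
    server or a class of positive rate is that one ([single_component]). *)

(** * Finite sums over sets *)

Lemma sum_setUI (R : numDomainType) (T : finType) (A B : {set T}) (F : T -> R) :
  \sum_(x in A :|: B) F x + \sum_(x in A :&: B) F x
    = \sum_(x in A) F x + \sum_(x in B) F x.
Proof.
rewrite [in LHS]big_mkcond [X in _ + X]big_mkcond -big_split /=.
rewrite [in RHS]big_mkcond [X in _ = _ + X]big_mkcond -big_split /=.
apply: eq_bigr => x _; rewrite !inE.
by case: (x \in A); case: (x \in B); rewrite ?addr0 ?add0r.
Qed.

Lemma ler_sum_subset (R : numDomainType) (T : finType) (A B : {set T})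
    (F : T -> R) :
  (forall x, 0 <= F x) -> A \subset B ->
  \sum_(x in A) F x <= \sum_(x in B) F x.
Proof.
move=> F0 sAB; rewrite big_mkcond [leRHS]big_mkcond ler_sum // => x _.
by case: (boolP (x \in A)) => [/(subsetP sAB) -> //|_]; case: ifP.
Qed.

Lemma sum_sub_indicator (R : numDomainType) (T : finType) (A : {set T})
    (F : T -> R) (a : T) (t : R) :
  \sum_(x in A) (F x - t * (x == a)%:R)
    = \sum_(x in A) F x - t * (a \in A)%:R.
Proof.
rewrite sumrB -mulr_sumr; congr (_ - _ * _).
have [aA|aA] := boolP (a \in A).
  rewrite (bigD1 a) //= eqxx big1 ?addr0 // => x /andP[_ /negbTE ->] //.
by rewrite big1 // => x xA; case: eqP => // xa; rewrite -xa xA in aA.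
Qed.

Lemma finite_positive_lower_bound (R : realDomainType) (T : finType)
    (P : pred T) (F : T -> R) :
  (forall x, P x -> 0 < F x) ->
  exists2 d : R, 0 < d & forall x, P x -> d <= F x.
Proof.
move=> F0; exists (\big[Num.min/1]_(x | P x) F x).
  by apply: lt_bigmin => //; exact: ltr01.
by move=> x Px; exact: bigmin_le_cond.
Qed.

(** * Classes only served by a set of servers *)

Lemma mem_only_served_by (n m : nat) (M : 'M[bool]_(n, m)) (S : {set 'I_m}) i :
  reflect (forall j, M i j -> j \in S) (i \in only_served_by M S).
Proof.
rewrite inE sum_nat_eq0; apply: (iffP forall_inP) => [H j Mij|H j].
  by apply/negPn/negP => jS; have := H j; rewrite inE jS Mij => /(_ isT).
by rewrite inE => jS; case: (boolP (M i j)) => // /H; rewrite (negbTE jS).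
Qed.

Lemma only_served_byT (n m : nat) (M : 'M[bool]_(n, m)) :
  only_served_by M [set: 'I_m] = [set: 'I_n].
Proof.
by apply/setP => i; rewrite [RHS]inE; apply/mem_only_served_by => j _; rewrite inE.
Qed.

(** * Transportation with capacities *)

(** The cut condition of the transportation problem: no set of servers is
    overloaded by the classes that only it can serve.  At the empty set it says
    that classes without a server have rate zero. *)
Definition cut_condition (R : realType) (n m : nat) (mu : 'I_m -> R)
    (Lambda : 'I_n -> R) (M : 'M[bool]_(n, m)) : Prop :=
  forall S : {set 'I_m},
    \sum_(i in only_served_by M S) Lambda i <= \sum_(j in S) mu j.

(** The menu [M] without the edge [(i, j)]. *)
Definition delete_edge (n m : nat) (M : 'M[bool]_(n, m)) (i : 'I_n) (j : 'I_m) :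
    'M[bool]_(n, m) :=
  \matrix_(a, b) (M a b && ((a, b) != (i, j))).

Lemma only_served_by_delete_edge (n m : nat) (M : 'M[bool]_(n, m)) i j
    (T : {set 'I_m}) a :
  a \in only_served_by (delete_edge M i j) T ->
  a \in only_served_by M T \/
  [/\ a = i, j \notin T & forall b, M i b -> b \in j |: T].
Proof.
move=> /mem_only_served_by aT.
have aT' b : M a b -> (a, b) != (i, j) -> b \in T.
  by move=> Mab ne; apply: aT; rewrite mxE Mab.
have [ai|ai] := eqVneq a i; last first.
  by left; apply/mem_only_served_by => b /aT'; rewrite xpair_eqE (negbTE ai); apply.
subst a; have [jT|jT] := boolP (j \in T).
  left; apply/mem_only_served_by => b /aT'.
  by rewrite xpair_eqE eqxx; have [->|_ ->] := eqVneq b j.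
right; split=> // b /aT'; rewrite xpair_eqE eqxx !inE.
by case: eqVneq => //= _ ->.
Qed.

(** Deleting an edge keeps the cut condition as soon as the class it leaves has
    no arrivals, or some tight set contains its server but does not confine its
    class: uncrossing that tight set with a set [T] whose cut gains the class
    shows that [T] has room for it. *)
Lemma cut_condition_delete_edge (R : realType) (n m : nat) (mu : 'I_m -> R)
    (Lambda : 'I_n -> R) (M : 'M[bool]_(n, m)) i j :
  (forall a, 0 <= Lambda a) ->
  cut_condition mu Lambda M ->
  Lambda i = 0 \/
  (exists S : {set 'I_m}, [/\ j \in S, i \notin only_served_by M S
    & \sum_(a in only_served_by M S) Lambda a = \sum_(b in S) mu b]) ->
  cut_condition mu Lambda (delete_edge M i j).
Proof.
move=> L0 cut tight T.
set U := only_served_by M.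
have [iT|iT] := boolP (i \in only_served_by (delete_edge M i j) T); last first.
  apply: le_trans (cut T); apply: ler_sum_subset => //.
  apply/subsetP => a aT; have [//|[ai _ _]] := only_served_by_delete_edge aT.
  by case/negP: iT; rewrite -[X in X \in _]ai.
have [iUT|[_ jT iN]] := only_served_by_delete_edge iT.
  apply: le_trans (cut T); apply: ler_sum_subset => //.
  by apply/subsetP => a aT; have [//|[-> _ _]] := only_served_by_delete_edge aT.
have sub : only_served_by (delete_edge M i j) T \subset i |: U T.
  apply/subsetP => a aT; rewrite in_setU1.
  have [aU|[-> _ _]] := only_served_by_delete_edge aT; last by rewrite eqxx.
  by rewrite [X in _ || X]aU orbT.
apply: le_trans (ler_sum_subset L0 sub) _.
have [iUT|iUT] := boolP (i \in U T).
  rewrite (_ : i |: U T = U T); first exact: cut.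
  by apply/setUidPr; rewrite sub1set.
rewrite big_setU1 //=.
case: tight => [->|[S [jS iS eqS]]]; first by rewrite add0r; exact: cut.
have subU : i |: (U S :|: U T) \subset U (S :|: T).
  apply/subsetP => a; rewrite in_setU1 in_setU => /or3P[/eqP ->|aS|aT].
  - apply/mem_only_served_by => b /iN; rewrite !inE => /orP[/eqP ->|->].
      by rewrite jS.
    by rewrite orbT.
  - apply/mem_only_served_by => b /(mem_only_served_by _ _ _ aS).
    by rewrite inE => ->.
  - apply/mem_only_served_by => b /(mem_only_served_by _ _ _ aT).
    by rewrite inE orbC => ->.
have UI : U S :&: U T = U (S :&: T).
  apply/setP => a; rewrite in_setI; apply/andP/idP => [[aS aT]|aST].
    apply/mem_only_served_by => b Mab.
    by rewrite inE (mem_only_served_by _ _ _ aS _ Mab) (mem_only_served_by _ _ _ aT _ Mab).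
  by split; apply/mem_only_served_by => b /(mem_only_served_by _ _ _ aST);
     rewrite inE => /andP[].
have iN' : i \notin U S :|: U T by rewrite in_setU negb_or iS.
(* modularity of sums, the cuts at [S :|: T] and [S :&: T], tightness of [S] *)
have := ler_sum_subset L0 subU; rewrite big_setU1 //=.
have := cut (S :|: T); have := cut (S :&: T); rewrite -/U -UI.
have := sum_setUI (U S) (U T) Lambda; have := sum_setUI S T mu.
rewrite -/U in eqS *; lra.
Qed.

(** The largest amount that can be sent along [(i, j)] without violating the
    cut condition exhausts class [i] or makes tight some set that contains [j]
    but does not confine [i]. *)
Lemma saturating_push (R : realType) (n m : nat) (mu : 'I_m -> R)
    (Lambda : 'I_n -> R) (M : 'M[bool]_(n, m)) i j :
  M i j -> (forall a, 0 <= Lambda a) -> cut_condition mu Lambda M ->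
  exists t : R,
    let mu' b := mu b - t * (b == j)%:R in
    let Lambda' a := Lambda a - t * (a == i)%:R in
    [/\ 0 <= t, forall a, 0 <= Lambda' a, cut_condition mu' Lambda' M
      & Lambda' i = 0 \/
        exists S : {set 'I_m}, [/\ j \in S, i \notin only_served_by M S
          & \sum_(a in only_served_by M S) Lambda' a = \sum_(b in S) mu' b]].
Proof.
move=> Mij L0 cut; set U := only_served_by M.
(* what can still be sent from outside the classes confined to [S] into [S] *)
pose room (S : {set _}) := \sum_(b in S) mu b - \sum_(a in U S) Lambda a.
pose P (S : {set _}) := (j \in S) && (i \notin U S).
have room0 S : 0 <= room S by rewrite subr_ge0; exact: cut.
have [t [t0 tL tP tE]] : exists t, [/\ 0 <= t, t <= Lambda i,
    forall S, P S -> t <= room S & t = Lambda i \/ exists2 S, P S & t = room S].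
  have [/existsP[S0 /andP[PS0 ltS0]]|no] :=
    boolP [exists S, P S && (room S < Lambda i)].
    have [S PS minS] := arg_minP room PS0.
    exists (room S); split=> //; last by right; exists S.
    exact: le_trans (minS _ PS0) (ltW ltS0).
  exists (Lambda i); split=> //; last by left.
  move=> S PS; rewrite leNgt; apply/negP => lt.
  by move/negP: no; apply; apply/existsP; exists S; rewrite PS.
have sumE (S : {set _}) : \sum_(b in S) (mu b - t * (b == j)%:R)
      - \sum_(a in U S) (Lambda a - t * (a == i)%:R)
    = room S - t * ((j \in S)%:R - (i \in U S)%:R).
  by rewrite !sum_sub_indicator /room; lra.
exists t => /=; split=> //.
- move=> a; have [->|_] := eqVneq a i; first by rewrite mulr1 subr_ge0.
  by rewrite mulr0 subr0.
- move=> S; rewrite -subr_ge0 sumE subr_ge0.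
  have [iU|iU] := boolP (i \in U S).
    by rewrite (mem_only_served_by _ _ _ iU _ Mij) subrr mulr0.
  have [jS|jS] := boolP (j \in S); last by rewrite subr0 mulr0.
  by rewrite subr0 mulr1; apply: tP; rewrite /P jS.
case: tE => [->|[S PS tS]]; first by left; rewrite eqxx mulr1 subrr.
right; exists S; have /andP[jS iU] := PS; split=> //.
apply/esym/eqP; rewrite -subr_eq0 sumE jS (negbTE iU) subr0 mulr1 tS.
by rewrite subrr.
Qed.

(** The cut condition suffices for a feasible flow.  By induction on the number
    of edges: send as much as possible along one edge, then delete it. *)
Lemma feasible_flow_exists (R : realType) (n m : nat) (mu : 'I_m -> R)
    (Lambda : 'I_n -> R) (M : 'M[bool]_(n, m)) :
  (forall i, 0 <= Lambda i) -> cut_condition mu Lambda M ->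
  exists f, feasible_flow mu Lambda M f.
Proof.
have [N] := ubnP #|[set p | M p.1 p.2]|.
elim: N mu Lambda M => // N IH mu Lambda M ltN L0 cut.
have [[i j] /= Mij|noedge] := pickP (fun p => M p.1 p.2); last first.
  have UT S : only_served_by M S = [set: 'I_n].
    apply/setP => a; rewrite [RHS]inE; apply/mem_only_served_by => b Mab.
    by have := noedge (a, b); rewrite /= Mab.
  have L i : Lambda i = 0.
    have := cut set0; rewrite big_set0 UT => sum0.
    apply/eqP; rewrite eq_le L0 andbT; apply: le_trans sum0.
    by rewrite (bigD1 i) ?inE //= lerDl sumr_ge0.
  exists 0; split=> [a b|b|a|a b _]; rewrite ?mxE //.
    rewrite big1 => [|a _]; last by rewrite mxE.
    by have := cut [set b]; rewrite big_set1; apply: le_trans; rewrite sumr_ge0.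
  by rewrite big1 => [|b _]; rewrite ?L ?mxE.
have [t [t0 L'0 cut' tight]] := saturating_push Mij L0 cut.
have {}cut' := cut_condition_delete_edge L'0 cut' tight.
have [|f [f0 fmu fL fM]] := IH _ _ _ _ L'0 cut'.
  rewrite -ltnS; apply: leq_trans ltN; rewrite ltnS; apply/proper_card/properP; split.
    by apply/subsetP => p; rewrite !inE mxE => /andP[].
  by exists (i, j); rewrite inE ?mxE //= eqxx andbF.
exists (f + t *: delta_mx i j); split=> [a b|b|a|a b Mab].
- by rewrite !mxE addr_ge0 // mulr_ge0.
- rewrite -[leRHS](subrK (t * (b == j)%:R)).
  under eq_bigr do rewrite !mxE; rewrite big_split /= lerD //.
  rewrite -mulr_sumr ler_wpM2l //.
  rewrite (bigD1 i) //= eqxx big1 ?addr0 // => a /negbTE -> //.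
- rewrite -[RHS](subrK (t * (a == i)%:R)) -fL.
  under eq_bigr do rewrite !mxE; rewrite big_split /=; congr (_ + _).
  rewrite -mulr_sumr; congr (_ * _).
  by rewrite (bigD1 j) //= eqxx andbT big1 ?addr0 // => b /negbTE ->; rewrite andbF.
- rewrite !mxE fM ?mxE ?negb_and ?Mab // add0r.
  case: eqVneq => [ai|]; rewrite ?mulr0 //=; case: eqVneq => [bj|]; rewrite ?mulr0 //.
  by rewrite ai bj Mij in Mab.
Qed.

(** * The residual matching and its component *)

(** Strictness of the cut condition leaves room to reserve a small amount on
    every edge of a class with positive rate before solving the transportation
    problem for what remains. *)
Lemma positive_flow_exists (R : realType) (n m : nat) (mu : 'I_m -> R)
    (Lambda : 'I_n -> R) (M : 'M[bool]_(n, m)) :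
  (forall i, 0 <= Lambda i) -> \sum_i Lambda i = \sum_j mu j ->
  corrected_condition mu Lambda M ->
  exists2 f, feasible_flow mu Lambda M f
    & forall i j, M i j -> 0 < Lambda i -> 0 < f i j.
Proof.
move=> L0 bal [served strict].
pose e (i : 'I_n) (j : 'I_m) : R := (M i j && (0 < Lambda i))%:R.
have e0 i j : 0 <= e i j by exact: ler0n.
(* [K] bounds every sum of [e] below and is positive, hence a legal divisor *)
pose K := 1 + \sum_i \sum_j e i j.
have sume0 i : 0 <= \sum_j e i j by rewrite sumr_ge0.
have K0 : 0 < K by rewrite ltr_pwDl // sumr_ge0.
have rowK i : \sum_j e i j <= K.
  by rewrite /K (bigD1 i) //= addrCA lerDl addr_ge0 // sumr_ge0.
have colK (S : {set 'I_m}) : \sum_(j in S) \sum_i e i j <= K.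
  apply: (@le_trans _ _ (\sum_j \sum_i e i j)).
    by rewrite big_mkcond ler_sum // => j _; case: ifP => // _; rewrite sumr_ge0.
  by rewrite exchange_big lerDr.
have [d1 d1_gt0 d1P] : exists2 d : R, 0 < d & forall S : {set 'I_m},
    (S != set0) && (S \proper [set: 'I_m]) ->
    d <= \sum_(j in S) mu j - \sum_(i in only_served_by M S) Lambda i.
  apply: finite_positive_lower_bound => S /andP[S0 SP].
  by rewrite subr_gt0; exact: strict.
have [d2 d2_gt0 d2P] : exists2 d : R, 0 < d & forall i, 0 < Lambda i -> d <= Lambda i.
  exact: finite_positive_lower_bound.
pose d := Num.min d1 d2 / K.
have d_gt0 : 0 < d by rewrite divr_gt0 // lt_min d1_gt0.
have dK x : x <= K -> d * x <= Num.min d1 d2.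
  by move=> xK; rewrite -[leRHS](divfK (lt0r_neq0 K0)) ler_wpM2l // ltW.
pose Lambda' i := Lambda i - d * \sum_j e i j.
pose mu' j := mu j - d * \sum_i e i j.
have L'0 i : 0 <= Lambda' i.
  rewrite subr_ge0; have [Li|Li] := boolP (0 < Lambda i).
    apply: le_trans (d2P _ Li); apply: le_trans (dK _ (rowK i)) _.
    by rewrite ge_min lexx orbT.
  by rewrite big1 ?mulr0 // => j _; rewrite /e (negbTE Li) andbF.
have cut' : cut_condition mu' Lambda' M.
  move=> S; have [->|S0] := eqVneq S set0.
    rewrite big_set0 big1 // => i /mem_only_served_by iS.
    by have [j /iS] := served i; rewrite inE.
  have [->|ST] := eqVneq S [set: 'I_m].
    rewrite only_served_byT.
    under eq_bigl do rewrite inE; under [leRHS]eq_bigl do rewrite inE.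
    by rewrite !sumrB bal -!mulr_sumr exchange_big.
  have LU : \sum_(i in only_served_by M S) Lambda' i
      <= \sum_(i in only_served_by M S) Lambda i.
    by apply: ler_sum => i _; rewrite lerBlDr lerDl mulr_ge0 // ltW.
  apply: le_trans LU _; rewrite sumrB -mulr_sumr.
  have /d1P : (S != set0) && (S \proper [set: 'I_m]) by rewrite S0 properT.
  have := dK _ (colK S); have : Num.min d1 d2 <= d1 by rewrite ge_min lexx.
  lra.
have [f [f0 fmu fL fM]] := feasible_flow_exists L'0 cut'.
exists (\matrix_(i, j) (f i j + d * e i j)); last first.
  move=> i j Mij Li; rewrite mxE /e Mij Li mulr1.
  by apply: ltr_wpDl.
split=> [i j|j|i|i j Mij].
- by rewrite mxE addr_ge0 // mulr_ge0 // ltW.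
- under eq_bigr do rewrite mxE.
  by rewrite big_split /= -mulr_sumr -lerBrDr.
- under eq_bigr do rewrite mxE.
  by rewrite big_split /= -mulr_sumr fL subrK.
- by rewrite mxE fM // /e (negbTE Mij) mulr0 addr0.
Qed.

Lemma residual_matchingE (R : realType) (n m : nat) (mu : 'I_m -> R)
    (Lambda : 'I_n -> R) (M : 'M[bool]_(n, m)) i j :
  (forall i, 0 <= Lambda i) -> \sum_i Lambda i = \sum_j mu j ->
  corrected_condition mu Lambda M ->
  residual_matching mu Lambda M i j = M i j && (0 < Lambda i).
Proof.
move=> L0 bal HM; rewrite mxE; apply/asboolP/andP => [[f [f0 _ fL fM] fij]|[Mij Li]].
  split; first by apply/negPn/negP => /fM fij0; rewrite fij0 ltxx in fij.
  by rewrite -fL (bigD1 j) //= ltr_pwDl // sumr_ge0.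
have [f ff fpos] := positive_flow_exists L0 bal HM.
by exists f => //; exact: fpos.
Qed.

Lemma connect_bipartite_sym (n m : nat) (E : 'M[bool]_(n, m)) :
  connect_sym (bipartite_edge E).
Proof. by apply: sym_connect_sym => [[a|a] [b|b]]. Qed.

Lemma connect_isolated_class (n m : nat) (E : 'M[bool]_(n, m)) i v :
  (forall j, E i j = false) -> connect (bipartite_edge E) (inl i) v -> v = inl i.
Proof.
move=> iso /connectP[[|[a|b] p] /=]; first by move=> _ ->.
  by [].
by rewrite iso.
Qed.

Lemma mem_nodes_inl (n m : nat) (C : {set 'I_n}) (S : {set 'I_m}) i :
  (inl i \in nodes C S) = (i \in C).
Proof.
rewrite inE mem_imset; last by move=> x y [].
by case: imsetP => [[j]|_]; rewrite ?orbF.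
Qed.

Lemma mem_nodes_inr (n m : nat) (C : {set 'I_n}) (S : {set 'I_m}) j :
  (inr j \in nodes C S) = (j \in S).
Proof.
rewrite inE orbC mem_imset; last by move=> x y [].
by case: imsetP => [[i]|_]; rewrite ?orbF.
Qed.

Lemma nodesU (n m : nat) (C C' : {set 'I_n}) (S S' : {set 'I_m}) :
  nodes (C :|: C') (S :|: S') = nodes C S :|: nodes C' S'.
Proof.
by apply/setP => [[i|j]]; rewrite !(mem_nodes_inl, mem_nodes_inr, in_setU).
Qed.

Lemma path_joinedU (n m : nat) (E : 'M[bool]_(n, m)) C C' S S' v :
  path_joined E C S -> path_joined E C' S' ->
  v \in nodes C S -> v \in nodes C' S' ->
  path_joined E (C :|: C') (S :|: S').
Proof.
move=> P P' vC vC' x y.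
have to_v z : z \in nodes (C :|: C') (S :|: S') -> connect (bipartite_edge E) z v.
  by rewrite nodesU in_setU => /orP[zC|zC]; [exact: P|exact: P'].
move=> /to_v xv /to_v yv; apply: connect_trans xv _.
by rewrite connect_bipartite_sym.
Qed.

(** If the set [S] of servers reachable from a given one were proper, each
    class with positive rate would be confined to [S] or to its complement, and
    the two strict cut inequalities would add up to a total arrival rate below
    the total service rate. *)
Lemma servers_connected (R : realType) (n m : nat) (mu : 'I_m -> R)
    (Lambda : 'I_n -> R) (M E : 'M[bool]_(n, m)) :
  (forall i, 0 <= Lambda i) -> \sum_i Lambda i = \sum_j mu j ->
  corrected_condition mu Lambda M ->
  (forall i j, E i j = M i j && (0 < Lambda i)) ->
  forall j j', connect (bipartite_edge E) (inr j) (inr j').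
Proof.
move=> L0 bal [_ strict] EE j0 j'.
pose S := [set j | connect (bipartite_edge E) (inr j0) (inr j)].
suff ST : S = [set: 'I_m] by have := in_setT j'; rewrite -ST inE.
apply/eqP/negPn/negP => SnT.
have S0 : S != set0 by apply/set0Pn; exists j0; rewrite inE connect0.
have cS0 : ~: S != set0 by rewrite -subset0 -setCS setCK setC0 -subTset in SnT *.
have cSnT : ~: S != [set: 'I_m] by rewrite -setC0 (inj_eq (@setC_inj _)).
have ltS : \sum_(i in only_served_by M S) Lambda i < \sum_(j in S) mu j.
  by apply: strict; rewrite ?properT.
have ltcS : \sum_(i in only_served_by M (~: S)) Lambda i < \sum_(j in ~: S) mu j.
  by apply: strict; rewrite ?properT.
have step a b c : 0 < Lambda a -> M a b -> M a c -> b \in S -> c \in S.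
  move=> La Mab Mac; rewrite !inE => /connect_trans; apply.
  apply: (@connect_trans _ _ (inl a)); apply: connect1; rewrite /= EE La.
    by rewrite Mab.
  by rewrite Mac.
have split_mu : \sum_j mu j = \sum_(j in S) mu j + \sum_(j in ~: S) mu j.
  rewrite (bigID (mem S)) /=; congr (_ + _).
  by apply: eq_bigl => j; rewrite in_setC.
have : \sum_i Lambda i <= \sum_(i in only_served_by M S) Lambda i
    + \sum_(i in only_served_by M (~: S)) Lambda i.
  rewrite [X in _ <= X + _]big_mkcond [X in _ <= _ + X]big_mkcond -big_split /=.
  apply: ler_sum => i _.
  have [Li|Li] := boolP (0 < Lambda i); last first.
    have -> : Lambda i = 0 by apply/eqP; rewrite eq_le L0 leNgt Li.
    by rewrite !if_same addr0.
  have [iS|/mem_only_served_by iS] := boolP (i \in only_served_by M S).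
    by rewrite lerDl; case: ifP.
  have -> : i \in only_served_by M (~: S).
    apply/mem_only_served_by => b Mib; rewrite inE; apply/negP => bS.
    by apply: iS => c Mic; exact: step Li Mib Mic bS.
  by rewrite add0r.
by rewrite bal split_mu leNgt ltrD.
Qed.

(** The component consists of all servers and all classes with positive rate. *)
Lemma single_component (R : realType) (n m : nat) (mu : 'I_m -> R)
    (Lambda : 'I_n -> R) (M : 'M[bool]_(n, m)) :
  (0 < m)%N -> (forall i, 0 <= Lambda i) -> \sum_i Lambda i = \sum_j mu j ->
  corrected_condition mu Lambda M ->
  single_CRP_component mu Lambda M.
Proof.
move=> m_gt0 L0 bal HM; pose E := residual_matching mu Lambda M.
have EE i j : E i j = M i j && (0 < Lambda i) by exact: residual_matchingE.
have conn := servers_connected L0 bal HM EE.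
pose j0 : 'I_m := Ordinal m_gt0.
pose C0 := [set i | 0 < Lambda i]; pose T0 := [set: 'I_m].
have P0 : path_joined E C0 T0.
  have to_j0 z : z \in nodes C0 T0 -> connect (bipartite_edge E) z (inr j0).
    case: z => [i|j _]; last exact: conn.
    rewrite mem_nodes_inl inE => Li; have [j Mij] := HM.1 i.
    by apply: connect_trans (conn j j0); apply: connect1; rewrite /= EE Mij.
  move=> x y /to_j0 xj /to_j0 yj; apply: connect_trans xj _.
  by rewrite connect_bipartite_sym.
have max0 (C : {set 'I_n}) (S : {set 'I_m}) :
    C0 \subset C -> T0 \subset S -> path_joined E C S -> C = C0 /\ S = T0.
  move=> sC sS PCS; have ST : S = T0 by apply/eqP; rewrite -subTset.
  split=> //; apply/eqP; rewrite eqEsubset sC andbT; apply/subsetP => i iC.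
  rewrite inE; apply/negPn/negP => Li.
  have iso j : E i j = false by rewrite EE (negbTE Li) andbF.
  have : connect (bipartite_edge E) (inl i) (inr j0).
    by apply: PCS; rewrite ?mem_nodes_inl ?mem_nodes_inr // ST inE.
  by move/(connect_isolated_class iso).
exists (C0, T0); split=> [|[C S] /= [[PCS maxCS] nontriv]].
  split; first by [].
  by case=> /= T00; have := in_setT j0; rewrite -/T0 T00 inE.
have [v vCS v0] : exists2 v, v \in nodes C S & v \in nodes C0 T0.
  have [S0|/set0Pn[j jS]] := eqVneq S set0; last first.
    by exists (inr j); rewrite mem_nodes_inr // inE.
  have [/existsP[i /andP[iC Li]]|no] := boolP [exists i, (i \in C) && (0 < Lambda i)].
    by exists (inl i); rewrite mem_nodes_inl // inE.
  case: nontriv; split=> // i iC; apply/eqP; rewrite eq_le L0 andbT leNgt.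
  by apply/negP => Li; case/negP: no; apply/existsP; exists i; rewrite iC.
have PU := path_joinedU PCS P0 vCS v0.
have [CU SU] := maxCS _ _ (subsetUl _ _) (subsetUl _ _) PU.
have [||-> -> //] := max0 C S _ _ PCS; first by rewrite -CU subsetUr.
by rewrite -SU subsetUr.
Qed.

(** * Admissibility *)

(** The slack of [S] is its limit plus a term linear in eps plus an error
    bounded by the number of classes times a uniform bound on the remainders. *)
Lemma slack_lower_bound (R : realType) (n m : nat) (mu : 'I_m -> R)
    (Lambda Gamma : 'I_n -> R) (M : 'M[bool]_(n, m)) lambda
    (S : {set 'I_m}) (c eps : R) :
  0 <= c ->
  (forall i, `|lambda eps i - (Lambda i - Gamma i * eps)| <= c) ->
  (\sum_(j in S) mu j - \sum_(i in only_served_by M S) Lambda i)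
    + (\sum_(i in only_served_by M S) Gamma i) * eps - n%:R * c
  <= slack mu M lambda S eps.
Proof.
move=> c0 Hc; rewrite /slack; set U := only_served_by M S.
have : \sum_(i in U) lambda eps i
    <= \sum_(i in U) (Lambda i - Gamma i * eps) + \sum_(i in U) c.
  rewrite -big_split /=; apply: ler_sum => i _; rewrite -lerBlDl.
  exact: le_trans (ler_norm _) (Hc i).
have : \sum_(i in U) c <= n%:R * c.
  rewrite sumr_const -[leLHS]mulr_natl ler_wpM2r // ler_nat.
  by rewrite -[leqRHS]card_ord max_card.
rewrite sumrB -mulr_suml; lra.
Qed.

Lemma near_arrival_rates (R : realType) (n : nat) (Lambda Gamma : 'I_n -> R)
    lambda (c : R) :
  0 < c -> arrival_rates Lambda Gamma lambda ->
  \forall eps \near at_right (0 : R),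
    forall i, `|lambda eps i - (Lambda i - Gamma i * eps)| <= c * eps.
Proof.
move=> c0 [lo _]; apply: filter_forall => i.
have /eqoP /(_ c c0) small := lo i.
near=> eps; have eps0 : 0 < eps by near: eps; exact: nbhs_right_gt.
by rewrite -{3}(gtr0_norm eps0); near: eps.
Unshelve. all: by end_near.
Qed.

Lemma strict_condition_admissible (R : realType) (n m : nat) (mu : 'I_m -> R)
    (Lambda : 'I_n -> R) (M : 'M[bool]_(n, m)) (Gamma : 'I_n -> R) :
  \sum_i Lambda i = \sum_j mu j -> corrected_condition mu Lambda M ->
  0 < \sum_i Gamma i -> admissible_for_slacks mu Lambda M Gamma.
Proof.
move=> bal [_ strict] G0 lambda Hlambda S S0.
have [->|ST] := eqVneq S [set: 'I_m].
  (* the limit slack vanishes and the linear term [|Gamma| eps] dominates *)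
  pose G := \sum_i Gamma i; pose c := G / 2 / n.+1%:R.
  have G20 : 0 < G / 2 by rewrite divr_gt0.
  have c0 : 0 < c by rewrite divr_gt0.
  have nc : n%:R * c <= G / 2.
    by rewrite mulrC /c mulrAC ler_pdivrMr // ler_pM2l // ler_nat.
  exists (G / 2) => //; near=> eps.
  have eps0 : 0 < eps by near: eps; exact: nbhs_right_gt.
  have ceps : 0 <= c * eps by rewrite mulr_ge0 // ltW.
  have Hc : forall i, `|lambda eps i - (Lambda i - Gamma i * eps)| <= c * eps.
    by near: eps; exact: near_arrival_rates.
  apply: le_trans (slack_lower_bound mu M [set: 'I_m] ceps Hc).
  rewrite only_served_byT.
  have -> : \sum_(j in [set: 'I_m]) mu j = \sum_j mu j by apply: eq_bigl => j; rewrite inE.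
  have -> : \sum_(i in [set: 'I_n]) Lambda i = \sum_i Lambda i
    by apply: eq_bigl => i; rewrite inE.
  have -> : \sum_(i in [set: 'I_n]) Gamma i = G by apply: eq_bigl => i; rewrite inE.
  rewrite bal subrr add0r mulrA -mulrBl ler_wpM2r ?(ltW eps0) //; lra.
have := strict S S0; rewrite properT -subr_gt0 => /(_ ST).
set D := _ - _ => D0; set U := only_served_by M S in D D0 *.
pose B := 1 + `|\sum_(i in U) Gamma i| + n%:R.
have B0 : 0 < B by rewrite /B -addrA ltr_pwDl // addr_ge0.
exists 1 => //; near=> eps.
have eps0 : 0 < eps by near: eps; exact: nbhs_right_gt.
have Beps : B * eps <= D.
  by rewrite mulrC -ler_pdivlMr //; near: eps; apply: nbhs_right_le; rewrite divr_gt0.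
have Hc : forall i, `|lambda eps i - (Lambda i - Gamma i * eps)| <= 1 * eps.
  by near: eps; exact: near_arrival_rates.
have ceps : 0 <= 1 * eps by rewrite mul1r ltW.
apply: le_trans (slack_lower_bound mu M S ceps Hc); rewrite -/U -/D.
have : - `|\sum_(i in U) Gamma i| * eps <= (\sum_(i in U) Gamma i) * eps.
  by rewrite ler_wpM2r ?(ltW eps0) // lerNl -normrN ler_norm.
by move: Beps; rewrite /B !mulrDl; lra.
Unshelve. all: by end_near.
Qed.

(** The printed condition cannot hold, as its instance at the empty set
    reads [0 < 0]. *)
Lemma printed_condition_absurd (R : realType) (n m : nat) (mu : 'I_m -> R)
    (Lambda : 'I_n -> R) (M : 'M[bool]_(n, m)) :
  (0 < m)%N -> ~ printed_condition mu Lambda M.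
Proof.
move=> m_gt0 /(_ set0); rewrite !big_set0 ltxx => H.
suff /H : set0 \proper [set: 'I_m] by [].
by rewrite properT eq_sym; apply/set0Pn; exists (Ordinal m_gt0); rewrite inE.
Qed.

Unset Implicit Arguments.
Set Strict Implicit.

Theorem proposition5 (R : realType) (n m : nat)
    (mu : 'I_m -> R) (Lambda : 'I_n -> R) (M : 'M[bool]_(n, m))
    (m_gt0 : (0 < m)%N)
    (mu_gt0 : forall j, 0 < mu j)
    (Lambda_ge0 : forall i, 0 <= Lambda i)
    (balanced : \sum_i Lambda i = \sum_j mu j)
    (HM : printed_condition mu Lambda M \/ corrected_condition mu Lambda M) :
  (forall Gamma : 'I_n -> R, 0 < \sum_i Gamma i ->
     admissible_for_slacks mu Lambda M Gamma)
  /\ single_CRP_component mu Lambda M.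
Proof.
have {}HM : corrected_condition mu Lambda M.
  by case: HM => // /(printed_condition_absurd m_gt0).
split; last exact: single_component.
by move=> Gamma; exact: strict_condition_admissible.
Qed.
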